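(* For every integer $n\geq 0$ and every $x\in\mathbb{C}$, $$(6x)^{n-1}\sum_{k=0}^{\lfloor n/2\rfloor}\binom{n}{2k}(36x^2-4)^k B_{2k}\,B^*_{n-2k}(x) = n\Bigl(\sum_{k=0}^{n-1}\binom{n-1}{k}B^*_{2k+1}(x) - \frac{(6x)^n}{2}B^*_{n-1}(x)\Bigr)$$ and $$(6x)^{n-1}\sum_{k=0}^{\lfloor n/2\rfloor}\binom{n}{2k}(4^k-1)(36x^2-4)^k B_{2k}\,C_{n-2k}(x) = n\Bigl(\sum_{k=0}^{n-1}\binom{n-1}{k}C_{2k+1}(x) - \frac{(6x)^n}{2}C_{n-1}(x)\Bigr).$$
   Context: $B_n$ denotes the $n$-th Bernoulli number, defined by $\sum_{n\ge0}B_n\frac{z^n}{n!}=\frac{z}{e^z-1}$. The balancing polynomials are defined by $B^*_0(x)=0$, $B^*_1(x)=1$, $B^*_n(x)=6xB^*_{n-1}(x)-B^*_{n-2}(x)$ for $n\ge2$. The Lucas-balancing polynomials are defined by $C_0(x)=1$, $C_1(x)=3x$, $C_n(x)=6xC_{n-1}(x)-C_{n-2}(x)$ for $n\ge2$. Convention $0^0=1$. For $n=0$ both sides are interpreted as $0$ (the left side contains the factor $B^*_0(x)=0$, resp. $4^0-1=0$, and the right side the factor $n$). *)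

(* Defs.v *)
From HB Require Import structures.
From mathcomp Require Import all_boot all_order all_algebra.
From mathcomp Require Import reals complex.

Set Implicit Arguments.
Unset Strict Implicit.
Unset Printing Implicit Defensive.

Import GRing.Theory Num.Theory.
Local Open Scope ring_scope.

(* A formal power series over F is given by its coefficient sequence nat -> F. *)
Definition fps_mul (F : pzRingType) (f g : nat -> F) (n : nat) : F :=
  \sum_(i < n.+1) f i * g (n - i)%N.

Definition egf (F : unitRingType) (a : nat -> F) (n : nat) : F :=
  a n / n`!%:R.

(* (\sum_n B_n z^n / n!) * (e^z - 1) = z, as formal power series over rat;     *)
(* the series e^z - 1 is the exponential generating series of 0, 1, 1, 1, ...  *)
Definition bernoulli_spec (B : nat -> rat) : Prop :=
  forall n, fps_mul (egf B) (egf (fun m => (m != 0%N)%:R)) n = (n == 1%N)%:R.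

Lemma bernoulli_spec_uniq (B B' : nat -> rat) :
  bernoulli_spec B -> bernoulli_spec B' -> B =1 B'.
Proof.
move=> hB hB'; elim/ltn_ind=> n IHn.
have := etrans (hB n.+1) (esym (hB' n.+1)); rewrite /fps_mul.
rewrite !big_ord_recr /= subnn /egf /= !mul0r !mulr0 !addr0 subSnn /= divr1.
rewrite !mulr1 (eq_bigr (fun i : 'I_n => B' i / i`!%:R *
  ((n.+1 - i != 0)%N%:R / (n.+1 - i)`!%:R))); last first.
  by move=> i _; rewrite IHn.
move/addrI => e; apply: (mulIf _ e).
by rewrite invr_eq0 pnatr_eq0 -lt0n fact_gt0.
Qed.

Lemma bernoulli_exists : {B : nat -> rat | bernoulli_spec B}.
Proof.
pose d n : rat := (n != 0%N)%:R / n`!%:R.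
pose next (s : seq rat) : rat := let n := size s in
  ((n == 0%N)%:R - \sum_(i < n) s`_i / i`!%:R * d (n.+1 - i)%N) * n`!%:R.
pose s n := iter n (fun s => rcons s (next s)) [::].
have ss n : size (s n) = n by elim: n => //= n IHn; rewrite size_rcons IHn.
have sE m n : (m < n)%N -> (s n)`_m = next (s m).
  elim: n => // n IHn; rewrite ltnS leq_eqVlt /= nth_rcons ss.
  by case/predU1P => [->|lt_mn]; [rewrite ltnn eqxx | rewrite lt_mn IHn].
exists (fun n => next (s n)) => -[|n].
  by rewrite /fps_mul big_ord_recr big_ord0 /egf /= mul0r mulr0 addr0.
rewrite /fps_mul !big_ord_recr /= subnn /egf /= mul0r mulr0 addr0 subSnn divr1.
rewrite /next ss mulfK; last by rewrite pnatr_eq0 -lt0n fact_gt0.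
rewrite eqSS addrC -[RHS]addr0 -addrA; congr (_ + _); apply/eqP.
rewrite addrC subr_eq0; apply/eqP.
by apply: eq_bigr => i _; rewrite sE.
Qed.

Definition bernoulli : nat -> rat := sval bernoulli_exists.

Fixpoint balancing_poly (F : nzRingType) (n : nat) : {poly F} :=
  match n with
  | 0 => 0
  | 1 => 1
  | (m.+1 as p).+1 => 6 *: 'X * balancing_poly F p - balancing_poly F m
  end.

Fixpoint lucas_balancing_poly (F : nzRingType) (n : nat) : {poly F} :=
  match n with
  | 0 => 1
  | 1 => 3 *: 'X
  | (m.+1 as p).+1 =>
      6 *: 'X * lucas_balancing_poly F p - lucas_balancing_poly F m
  end.

(* Main.v *)
(* Write y = 6x, let a, b be the roots of X^2 - y X + 1 and d = a - b, so that
   d^2 = 36x^2 - 4, d B*_n = a^n - b^n and 2 C_n = a^n + b^n.  With the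
   homogenized Bernoulli polynomials P_n(s; t) = s^n B_n(t / s), averaging over
   s and -s keeps exactly the even-index Bernoulli numbers.  The difference
   equation P_n(d; a) - P_n(d; b) = n d b^(n-1) and its image under a <-> b then
   turn the first Bernoulli sum into n C_(n-1); the duplication formula
   P_n(2d; b) + P_n(2d; a) = 2 P_n(d; b) turns the second one into
   n (d^2 / 4) B*_(n-1).  On the right-hand sides, y u_(m+1) = u_m + u_(m+2)
   gives \sum_k 'C(n-1, k) u_(2k+1) = y^(n-1) u_n, and what remains is
   C_n = B*_(n+1) - (y/2) B*_n and (d^2/4) B*_n = C_(n+1) - (y/2) C_n. *)

Require Import Defs.
From HB Require Import structures.
From mathcomp Require Import all_boot all_order all_algebra.
From mathcomp Require Import reals complex.
From mathcomp Require Import ring.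

Set Implicit Arguments.
Unset Strict Implicit.
Unset Printing Implicit Defensive.

Import GRing.Theory Num.Theory.
Local Open Scope ring_scope.
Local Open Scope complex_scope.

(** * Bernoulli recurrence and extraction of even indices *)

(** Coefficient of [z^n] in the defining series identity, multiplied by [n!]; the term [i = n] drops
    out because [e^z - 1] has no constant term. *)
Lemma bernoulli_sum n : \sum_(i < n) 'C(n, i)%:R * bernoulli i = (n == 1%N)%:R.
Proof.
have fact_neq0 m : m`!%:R != 0 :> rat by rewrite pnatr_eq0 -lt0n fact_gt0.
have := svalP bernoulli_exists n; rewrite -/bernoulli.
rewrite /fps_mul big_ord_recr /= subnn /egf /= mul0r mulr0 addr0.
move/(congr1 ( *%R n`!%:R)); rewrite mulr_sumr.
have -> : n`!%:R * (n == 1)%:R = (n == 1)%:R :> rat.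
  by case: eqP => [->|_]; rewrite (mulr1, mulr0).
move=> <-; apply: eq_bigr => i _.
have lt_in := ltn_ord i.
rewrite -(bin_fact (ltnW lt_in)) !natrM subn_eq0 leqNgt lt_in /=.
by field; rewrite !fact_neq0.
Qed.

Lemma sum_even (F : comPzRingType) (G : nat -> F) n :
  \sum_(i < n.+1) (1 + (-1) ^+ i) * G i = 2 * \sum_(k < n./2.+1) G (2 * k)%N.
Proof.
elim: n => [|n IHn]; first by rewrite !big_ord_recr !big_ord0 /= expr0 !add0r.
rewrite big_ord_recr IHn /= -signr_odd /= uphalf_half.
case: (boolP (odd n)) => odd_n /=; last by rewrite expr1 subrr mul0r addr0.
rewrite add1n [in RHS]big_ord_recr /= mulrDr expr0.
suff -> : (2 * (n./2).+1 = n.+1)%N by [].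
by rewrite mul2n doubleS -[in RHS](odd_double_half n) odd_n.
Qed.

(** * Appell sequences of polynomials *)

Lemma deriv_eq0 (F : numDomainType) (p : {poly F}) :
  p^`() = 0 -> p = p.[0]%:P.
Proof.
move=> dp0; apply/polyP => -[|i]; rewrite coefC /= ?horner_coef0 //.
by have /eqP := congr1 (fun q : {poly F} => q`_i) dp0;
  rewrite coef_deriv coef0 mulrn_eq0 /= => /eqP.
Qed.

(** At [n = 0] the factor [n%:R] makes this say that [Q 0] has zero derivative, so the convention
    [0.-1 = 0] is harmless. *)
Definition appell (F : nzRingType) (Q : nat -> {poly F}) :=
  forall n, (Q n)^`() = n%:R *: Q n.-1.

Lemma appellB (F : nzRingType) (P Q : nat -> {poly F}) :
  appell P -> appell Q -> appell (fun n => P n - Q n).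
Proof. by move=> hP hQ n; rewrite derivB hP hQ scalerBr. Qed.

Lemma appellD (F : nzRingType) (P Q : nat -> {poly F}) :
  appell P -> appell Q -> appell (fun n => P n + Q n).
Proof. by move=> hP hQ n; rewrite derivD hP hQ scalerDr. Qed.

Lemma appellZ (F : comNzRingType) c (P : nat -> {poly F}) :
  appell P -> appell (fun n => c *: P n).
Proof. by move=> hP n; rewrite derivZ hP !scalerA mulrC. Qed.

Lemma appell_shift (F : comNzRingType) c (P : nat -> {poly F}) :
  appell P -> appell (fun n => P n \Po ('X + c%:P)).
Proof.
by move=> hP n; rewrite deriv_comp hP derivD derivX derivC addr0 mulr1
  comp_polyZ.
Qed.

(** This is the right-hand side of the Bernoulli difference equation; once it is known to be Appell,
    that equation has to be checked at 0 only. *)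
Lemma appell_monomial (F : comNzRingType) (s : F) :
  appell (fun n => (n%:R * s) *: 'X^(n.-1)).
Proof.
move=> n; rewrite derivZ derivXn -scaler_nat !scalerA.
by congr (_ *: _); ring.
Qed.

(** By induction the derivative of [Q n] vanishes, so [Q n] is the constant [(Q n).[0]]. *)
Lemma appell_eq0 (F : numDomainType) (Q : nat -> {poly F}) :
  appell Q -> (forall n, (Q n).[0] = 0) -> forall n, Q n = 0.
Proof.
move=> hQ Q0; elim=> [|n IHn]; rewrite (deriv_eq0 (p := Q _)) ?Q0 //.
  by rewrite hQ scale0r.
by rewrite hQ /= IHn scaler0.
Qed.

(* If Q_(n-1) vanishes, Q_n is a constant c, so Q_(n+1) = (n+1) c X + c', and
   Q_(n+1) can only take the same value at 0 and s when c = 0. *)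
Lemma appell_periodic_eq0 (F : numDomainType) (s : F) (Q : nat -> {poly F}) :
  s != 0 -> appell Q -> (forall n, (Q n).[s] = (Q n).[0]) ->
  forall n, Q n = 0.
Proof.
move=> s0 hQ Qs.
suff const_eq0 n : (Q n)^`() = 0 -> Q n = 0.
  elim=> [|n IHn]; apply: const_eq0; first by rewrite hQ scale0r.
  by rewrite hQ /= IHn scaler0.
move/deriv_eq0; set c := (Q n).[0] => Qn.
have : (Q n.+1 - (n.+1%:R * c) *: 'X)^`() = 0.
  by rewrite derivB derivZ derivX hQ /= Qn -!mul_polyC mulr1 polyCM subrr.
move/deriv_eq0/(congr1 (horner^~ s)); rewrite !hornerE Qs subr0.
move/eqP; rewrite -subr_eq0 addrAC subrr sub0r oppr_eq0 !mulf_eq0 pnatr_eq0.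
by rewrite (negPf s0) orbF /= Qn => /eqP ->.
Qed.

(* s^n B_n('X / s), where B_n is the n-th Bernoulli polynomial *)
Definition hom_bernoulli (F : numFieldType) (s : F) n : {poly F} :=
  \sum_(i < n.+1) ('C(n, i)%:R * ratr (bernoulli i) * s ^+ i) *: 'X^(n - i).

(** * Homogenized Bernoulli polynomials: difference equation, duplication, even part *)

Section HomBernoulli.
Variable F : numFieldType.
Implicit Types (s t : F) (n : nat).

Lemma appell_hom_bernoulli s : appell (hom_bernoulli s).
Proof.
move=> [|n]; rewrite raddf_sum scaler_sumr /=.
  by rewrite big_ord1 big1 ?derivZ ?derivXn ?scaler0 // => i _; rewrite scale0r.
rewrite big_ord_recr /= subnn derivZ derivC scaler0 addr0.
apply: eq_bigr => i _.
rewrite derivZ derivXn -scaler_nat !scalerA subSn -1?ltnS //=; congr (_ *: _).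
(* Termwise, the claim is [(n+1-i) C(n+1,i) = (n+1) C(n,i)]. *)
have := congr1 (fun m => m%:R : F) (mul_bin_down n.+1 i).
rewrite /= subSn -1?ltnS // !natrM => e.
by rewrite [RHS]mulrA [in RHS]mulrA e; ring.
Qed.

Lemma horner_hom_bernoulli s n t : (hom_bernoulli s n).[t] =
  \sum_(i < n.+1) 'C(n, i)%:R * ratr (bernoulli i) * s ^+ i * t ^+ (n - i).
Proof.
by rewrite horner_sum; apply: eq_bigr => i _; rewrite hornerZ hornerXn.
Qed.

Lemma hom_bernoulli0 s n : (hom_bernoulli s n).[0] = ratr (bernoulli n) * s ^+ n.
Proof.
rewrite horner_hom_bernoulli big_ord_recr /= subnn binn mul1r mulr1 big1 ?add0r //.
by move=> i _; rewrite expr0n subn_eq0 leqNgt ltn_ord mulr0.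
Qed.

(** Both sides are Appell, and at 0 the equation reduces to the recurrence [bernoulli_sum]
    multiplied by [s^n]. *)
Lemma hom_bernoulli_shift s n :
  hom_bernoulli s n \Po ('X + s%:P) - hom_bernoulli s n
  = (n%:R * s) *: 'X^(n.-1).
Proof.
apply/eqP; rewrite -subr_eq0; apply/eqP; move: n; apply: appell_eq0.
  have hP := appell_hom_bernoulli s.
  exact: appellB (appellB (appell_shift s hP) hP) (appell_monomial s).
move=> n; rewrite !hornerE horner_comp !hornerE hom_bernoulli0.
rewrite horner_hom_bernoulli big_ord_recr /= subnn binn mul1r mulr1 addrK.
have -> : \sum_(i < n) 'C(n, i)%:R * ratr (bernoulli i) * s ^+ i * s ^+ (n - i)
    = ratr (\sum_(i < n) 'C(n, i)%:R * bernoulli i) * s ^+ n.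
  rewrite rmorph_sum mulr_suml; apply: eq_bigr => i _ /=.
  by rewrite rmorphM /= ratr_nat -mulrA -exprD subnKC // ltnW.
rewrite bernoulli_sum ratr_nat; case: n => [|[|n]] /=.
- by rewrite !mul0r subrr.
- by rewrite expr0 expr1; ring.
- by rewrite expr0n /= !mul0r mulr0 subrr.
Qed.

Lemma horner_hom_bernoulli_shift s n t :
  (hom_bernoulli s n).[t + s] - (hom_bernoulli s n).[t] = n%:R * s * t ^+ n.-1.
Proof.
have := congr1 (horner^~ t) (hom_bernoulli_shift s n).
by rewrite !hornerE horner_comp !hornerE.
Qed.

(** The difference [Q] of the two sides is Appell. By the difference equations with steps [2s] and
    [s], [Q(s) - Q(0)] is [n (2s) 0^(n-1) - 2 n s 0^(n-1) = 0], so [appell_periodic_eq0] applies. *)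
Lemma hom_bernoulli_duplication s n t : s != 0 ->
  (hom_bernoulli (2 * s) n).[t] + (hom_bernoulli (2 * s) n).[t + s]
  = 2 * (hom_bernoulli s n).[t].
Proof.
move=> s0; pose P := hom_bernoulli (2 * s).
pose Q m := P m + (P m \Po ('X + s%:P)) - 2 *: hom_bernoulli s m.
suff /(congr1 (horner^~ t)) : Q n = 0.
  rewrite /Q !hornerE horner_comp !hornerE => e.
  by apply/eqP; rewrite -subr_eq0 e.
move: n; apply: (appell_periodic_eq0 s0).
  have hP := appell_hom_bernoulli (2 * s).
  exact: appellB (appellD hP (appell_shift s hP))
    (appellZ 2 (appell_hom_bernoulli s)).
move=> n; rewrite /Q !hornerE !horner_comp !hornerE.
have e1 := horner_hom_bernoulli_shift s n 0.
have e2 := horner_hom_bernoulli_shift (2 * s) n 0.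
rewrite !add0r in e1 e2; rewrite (_ : s + s = 2 * s); last by ring.
rewrite -/P in e2; apply/eqP; rewrite -subr_eq0; apply/eqP.
transitivity ((P n).[2 * s] - (P n).[0]
  - 2 * ((hom_bernoulli s n).[s] - (hom_bernoulli s n).[0])); first by ring.
by rewrite e1 e2; ring.
Qed.

Lemma hom_bernoulli_even s n t :
  (hom_bernoulli s n).[t] + (hom_bernoulli (- s) n).[t] =
  2 * \sum_(k < n./2.+1)
        'C(n, 2 * k)%:R * (s ^+ 2) ^+ k * ratr (bernoulli (2 * k))
        * t ^+ (n - 2 * k).
Proof.
pose G i := 'C(n, i)%:R * s ^+ i * ratr (bernoulli i) * t ^+ (n - i).
rewrite !horner_hom_bernoulli -big_split /=.
under [in RHS]eq_bigr => k _ do rewrite -exprM -/(G (2 * k)%N).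
rewrite -sum_even; apply: eq_bigr => i _.
by rewrite /G [(- s) ^+ _]exprNn; ring.
Qed.

End HomBernoulli.

(** * The recurrence shared by both polynomial families *)

Definition balancing_rec (F : pzRingType) (y : F) (u : nat -> F) :=
  forall n, u n.+2 = y * u n.+1 - u n.

Lemma balancing_rec_eq (F : pzRingType) (y : F) (u v : nat -> F) :
  balancing_rec y u -> balancing_rec y v ->
  u 0%N = v 0%N -> u 1%N = v 1%N -> u =1 v.
Proof.
move=> hu hv e0 e1 n; suff [] : u n = v n /\ u n.+1 = v n.+1 by [].
by elim: n => // n [IH0 IH1]; split; rewrite // hu hv IH0 IH1.
Qed.

(** With [E] the index shift, the recurrence reads [1 + E^2 = y E], and this is its [m]-th power
    applied to [u] at [j]. *)
Lemma balancing_rec_binomial (F : comPzRingType) (y : F) (u : nat -> F) m j :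
  balancing_rec y u ->
  \sum_(k < m.+1) 'C(m, k)%:R * u (j + 2 * k)%N = y ^+ m * u (j + m)%N.
Proof.
move=> hu; elim: m j => [|m IHm] j; first by rewrite big_ord1 bin0 muln0.
rewrite big_ord_recl bin0 muln0 /=.
under eq_bigr => k _ do
  rewrite binS natrD mulrDl mulnS addnA.
rewrite big_split /= addrA IHm.
rewrite big_ord_recr /= bin_small // mul0r addr0.
(* Pascal's rule splits the sum into the sums for [m] starting at [j] and at [j + 2]; this
   reassembles the former. *)
have -> : 1%:R * u (j + 0)%N + \sum_(k < m) 'C(m, k.+1)%:R * u (j + 2 + 2 * k)%N
    = \sum_(k < m.+1) 'C(m, k)%:R * u (j + 2 * k)%N.
  rewrite big_ord_recl bin0 muln0; congr (_ + _).
  by apply: eq_bigr => k _; rewrite mulnS addnA.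
by rewrite IHm -mulrDr addn2 !addSn hu addrC subrK exprS addnS; ring.
Qed.

Lemma horner_balancing_rec (F : numFieldType) (x : F) :
  balancing_rec (6 * x) (fun n => (balancing_poly F n).[x]).
Proof. by move=> n; rewrite /= !hornerE. Qed.

Lemma horner_lucas_balancing_rec (F : numFieldType) (x : F) :
  balancing_rec (6 * x) (fun n => (lucas_balancing_poly F n).[x]).
Proof. by move=> n; rewrite /= !hornerE. Qed.

(** * Binet formulas and evaluation of the Bernoulli sums *)

Section Balancing.
Variables (F : numFieldType) (x a b : F).
Hypotheses (sum_ab : a + b = 6 * x) (mul_ab : a * b = 1).

Lemma lucas_balancing_rootl : a ^+ 2 = 6 * x * a - 1.
Proof. by rewrite -sum_ab -mul_ab; ring. Qed.

Lemma lucas_balancing_rootr : b ^+ 2 = 6 * x * b - 1.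
Proof. by rewrite -sum_ab -mul_ab; ring. Qed.

Lemma balancing_discriminant : (a - b) ^+ 2 = 36 * x ^+ 2 - 4.
Proof.
transitivity ((a + b) ^+ 2 - 4 * (a * b)); first by ring.
by rewrite sum_ab mul_ab; ring.
Qed.

Lemma horner_balancing n :
  (a - b) * (balancing_poly F n).[x] = a ^+ n - b ^+ n.
Proof.
move: n; apply: (@balancing_rec_eq _ (6 * x)) => [n|n||].
- by rewrite (horner_balancing_rec x n); ring.
- rewrite -addn2 !exprD lucas_balancing_rootl lucas_balancing_rootr !exprS.
  by ring.
- by rewrite /= !hornerE subrr.
- by rewrite /= !hornerE.
Qed.

Lemma horner_lucas_balancing n :
  2 * (lucas_balancing_poly F n).[x] = a ^+ n + b ^+ n.
Proof.
move: n; apply: (@balancing_rec_eq _ (6 * x)) => [n|n||].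
- by rewrite (horner_lucas_balancing_rec x n); ring.
- rewrite -addn2 !exprD lucas_balancing_rootl lucas_balancing_rootr !exprS.
  by ring.
- by rewrite /= !hornerE.
- by rewrite /= hornerZ hornerX !expr1 sum_ab; ring.
Qed.

(** For a double root the Binet formula degenerates to [0 = 0]; this is its limiting form, where
    [ab = 1] gives [a^2 = 1]. *)
Lemma horner_balancing_double n : a = b ->
  (balancing_poly F n).[x] = n%:R * a ^+ n.-1.
Proof.
move=> eq_ab; move: n; apply: (@balancing_rec_eq _ (6 * x)) => [n|n||].
- exact: (horner_balancing_rec x n).
- have a2 : a * a = 1 by rewrite {2}eq_ab.
  rewrite -sum_ab -eq_ab; case: n => [|n] /=; first by rewrite expr0; ring.
  rewrite !exprS; apply/eqP; rewrite -subr_eq0; apply/eqP.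
  transitivity ((a * a - 1) * - (n.+1%:R * a ^+ n)); first by ring.
  by rewrite a2 subrr mul0r.
- by rewrite /= hornerE mul0r.
- by rewrite /= hornerE mulr1.
Qed.

Lemma sum_bernoulli_balancing n :
  \sum_(k < n./2.+1)
     'C(n, 2 * k)%:R * (36 * x ^+ 2 - 4) ^+ k * ratr (bernoulli (2 * k)) *
     (balancing_poly F (n - 2 * k)).[x]
  = n%:R * (lucas_balancing_poly F (n - 1)).[x].
Proof.
rewrite -balancing_discriminant subn1; have [d0|d0] := eqVneq (a - b) 0.
  have eq_ab : a = b by apply/eqP; rewrite -subr_eq0 d0.
  (* For a double root only [k = 0] survives, leaving [B*_n = n a^(n-1)] to be compared with
     [n C_(n-1)], where [C_(n-1) = a^(n-1)]. *)
  rewrite big_ord_recl big1 ?addr0 => [|k _]; last first.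
    by rewrite d0 expr0n /= expr0n /= mulr0 !mul0r.
  have B0 : bernoulli 0 = 1%:R.
    by have := bernoulli_sum 1; rewrite big_ord1 bin0 mul1r.
  rewrite muln0 bin0 expr0 B0 ratr_nat !mul1r subn0 horner_balancing_double //.
  congr (_ * _); apply: (mulfI (_ : 2 != 0 :> F)); rewrite ?pnatr_eq0 //.
  by rewrite horner_lucas_balancing -eq_ab; ring.
(* The factor [a - b] produces the Binet form of [B*], the factor 2 that of [C] and the average over
   [s] and [-s]. *)
apply: (mulfI (mulf_neq0 (_ : 2 != 0 :> F) d0)); first by rewrite pnatr_eq0.
transitivity (n%:R * (a - b) * (2 * (lucas_balancing_poly F n.-1).[x]));
  last by ring.
rewrite horner_lucas_balancing.
(* Step [a - b] carries [b] to [a], and the opposite step carries [a] to [b]. *)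
have e1 := horner_hom_bernoulli_shift (a - b) n b.
have e2 := horner_hom_bernoulli_shift (- (a - b)) n a.
rewrite [b + _]addrC subrK in e1; rewrite subKr in e2.
transitivity (n%:R * (a - b) * b ^+ n.-1 - n%:R * - (a - b) * a ^+ n.-1);
  last by ring.
rewrite -e1 -e2; pose P (s t : F) := (hom_bernoulli s n).[t].
transitivity ((P (a - b) a + P (- (a - b)) a) - (P (a - b) b + P (- (a - b)) b));
  last by rewrite /P; ring.
rewrite /P !hom_bernoulli_even -mulrBr -sumrB -mulrA mulr_sumr; congr (_ * _).
by apply: eq_bigr => k _; rewrite mulrCA horner_balancing; ring.
Qed.

Lemma sum_bernoulli_lucas_balancing n :
  4 * (\sum_(k < n./2.+1)
     'C(n, 2 * k)%:R * (4 ^+ k - 1) * (36 * x ^+ 2 - 4) ^+ k *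
     ratr (bernoulli (2 * k)) * (lucas_balancing_poly F (n - 2 * k)).[x])
  = n%:R * (36 * x ^+ 2 - 4) * (balancing_poly F (n - 1)).[x].
Proof.
rewrite -balancing_discriminant subn1; have [d0|d0] := eqVneq (a - b) 0.
  (* For a double root every term vanishes: [k = 0] through [4^0 - 1], the others through a power of
     0. *)
  rewrite d0 expr0n /= mulr0 mul0r big1 ?mulr0 // => -[[|k] lt_k] _ /=.
    by rewrite expr0 subrr mulr0 !mul0r.
  by rewrite expr0n /= mulr0 !mul0r.
pose P (s t : F) := (hom_bernoulli s n).[t].
(* Duplication is used at [b] for [a - b] and at [a] for [b - a], so that both instances involve
   exactly the points [a] and [b]. *)
have dup1 := hom_bernoulli_duplication n b d0.
have := d0; rewrite -oppr_eq0 => /(hom_bernoulli_duplication n a) dup2.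
have e1 := horner_hom_bernoulli_shift (a - b) n b.
have e2 := horner_hom_bernoulli_shift (- (a - b)) n a.
rewrite [b + _]addrC subrK in e1 dup1; rewrite subKr in e2.
rewrite mulrN subKr in dup2.
transitivity (n%:R * (a - b) * ((a - b) * (balancing_poly F n.-1).[x]));
  last by ring.
rewrite horner_balancing.
transitivity (- (n%:R * (a - b) * b ^+ n.-1) - n%:R * - (a - b) * a ^+ n.-1);
  last by ring.
rewrite -e1 -e2 -!/(P _ _).
(* The factor [4^k - 1] is the even part for [2(a - b)] minus the one for [a - b]; adding the values
   at [a] and [b] produces [2 C_(n-2k)]. *)
transitivity (P (2 * (a - b)) a + P (- (2 * (a - b))) a
  + (P (2 * (a - b)) b + P (- (2 * (a - b))) b)
  - (P (a - b) a + P (- (a - b)) a) - (P (a - b) b + P (- (a - b)) b)).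
  rewrite /P !hom_bernoulli_even -mulrDr -!mulrBr -big_split -!sumrB /=.
  have four (u : F) : 4 * u = 2 * (2 * u) by ring.
  rewrite four mulr_sumr; congr (_ * _).
  apply: eq_bigr => k _; rewrite mulrCA horner_lucas_balancing.
  have -> : (2 * (a - b)) ^+ 2 = 4 * (a - b) ^+ 2 by ring.
  by rewrite [(4 * _) ^+ k]exprMn; ring.
transitivity (2 * P (a - b) b + 2 * P (- (a - b)) a
  - (P (a - b) a + P (- (a - b)) a) - (P (a - b) b + P (- (a - b)) b));
  last by ring.
by rewrite -dup1 -dup2 -!/(P _ _); ring.
Qed.

End Balancing.

(** * Linear relations between the two families *)

Section BalancingIdentities.
Variables (F : numFieldType) (x : F).

Lemma lucas_balancingE n : (lucas_balancing_poly F n).[x] =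
  (balancing_poly F n.+1).[x] - 3 * x * (balancing_poly F n).[x].
Proof.
move: n; apply: (@balancing_rec_eq _ (6 * x)) => [n|n||].
- exact: horner_lucas_balancing_rec.
- by rewrite (horner_balancing_rec x n.+1) (horner_balancing_rec x n); ring.
- by rewrite /= !hornerE; ring.
- by rewrite /= !hornerE; ring.
Qed.

(** Both sides satisfy the recurrence in [n], so two initial values suffice. *)
Lemma balancing_lucasE n : (36 * x ^+ 2 - 4) * (balancing_poly F n).[x] =
  4 * ((lucas_balancing_poly F n.+1).[x]
       - 3 * x * (lucas_balancing_poly F n).[x]).
Proof.
move: n; apply: (@balancing_rec_eq _ (6 * x)) => [n|n||].
- by rewrite (horner_balancing_rec x n); ring.
- by rewrite (horner_lucas_balancing_rec x n.+1)
    (horner_lucas_balancing_rec x n); ring.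
- by rewrite /= !(hornerZ, hornerX, hornerC); ring.
- by rewrite (horner_lucas_balancing_rec x 0) /= !(hornerZ, hornerX, hornerC);
    ring.
Qed.

End BalancingIdentities.

(** * Existence of the roots and assembly of both identities *)

Lemma balancing_roots (F : numClosedFieldType) (y : F) :
  exists a b : F, a + b = y /\ a * b = 1.
Proof.
exists ((y + sqrtC (y ^+ 2 - 4)) / 2), ((y - sqrtC (y ^+ 2 - 4)) / 2).
split; first by field.
transitivity ((y ^+ 2 - sqrtC (y ^+ 2 - 4) ^+ 2) / 4); first by field.
by rewrite sqrtCK; field.
Qed.

Lemma balancing_bernoulli_sums (F : numClosedFieldType) (n : nat) (x : F) :
  (6 * x) ^ (n%:Z - 1) *
    (\sum_(k < n./2.+1)
        'C(n, 2 * k)%:R * (36 * x ^+ 2 - 4) ^+ k * ratr (bernoulli (2 * k)) *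
        (balancing_poly F (n - 2 * k)).[x])
  = n%:R * (\sum_(k < n)
               'C(n - 1, k)%:R * (balancing_poly F (2 * k + 1)).[x]
            - (6 * x) ^+ n / 2 * (balancing_poly F (n - 1)).[x])
  /\
  (6 * x) ^ (n%:Z - 1) *
    (\sum_(k < n./2.+1)
        'C(n, 2 * k)%:R * (4 ^+ k - 1) * (36 * x ^+ 2 - 4) ^+ k *
        ratr (bernoulli (2 * k)) *
        (lucas_balancing_poly F (n - 2 * k)).[x])
  = n%:R * (\sum_(k < n)
               'C(n - 1, k)%:R * (lucas_balancing_poly F (2 * k + 1)).[x]
            - (6 * x) ^+ n / 2 * (lucas_balancing_poly F (n - 1)).[x]).
Proof.
(* At [n = 0] the exponent is -1, but the sums on the left vanish through [B*_0 = 0] and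
   [4^0 - 1 = 0]. *)
case: n => [|m]; first by rewrite !mul0r big_ord1 big_ord1 /= horner0
  subrr !(mulr0, mul0r).
have [a [b [sum_ab mul_ab]]] := balancing_roots (6 * x).
have four0 : 4 != 0 :> F by rewrite pnatr_eq0.
have odd_sum (u : nat -> F) : balancing_rec (6 * x) u ->
    \sum_(k < m.+1) 'C(m, k)%:R * u (2 * k + 1)%N = (6 * x) ^+ m * u m.+1.
  move=> /(balancing_rec_binomial m 1) <-.
  by apply: eq_bigr => k _; rewrite addnC.
(* From here on the exponent is the natural number [m], so [x = 0] is covered with [0^0 = 1]. *)
rewrite (_ : m.+1%:Z - 1 = m) -?exprnP; last by rewrite -addn1 PoszD addrK.
rewrite (sum_bernoulli_balancing sum_ab mul_ab) subSS subn0.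
rewrite (odd_sum _ (horner_balancing_rec x)).
rewrite (odd_sum _ (horner_lucas_balancing_rec x)); split.
  by rewrite lucas_balancingE exprS; field.
(* The second Bernoulli sum was evaluated with a factor 4, which also clears the denominator of
   [(36x^2 - 4)/4]. *)
apply: (mulfI four0); rewrite [LHS]mulrCA.
rewrite (sum_bernoulli_lucas_balancing sum_ab mul_ab) subSS subn0.
by rewrite -[m.+1%:R * _ * _]mulrA balancing_lucasE exprS; field.
Qed.

Theorem theorem11 (R : realType) (n : nat) (x : R[i]) :
  (6 * x) ^ (n%:Z - 1) *
    (\sum_(k < n./2.+1)
        'C(n, 2 * k)%:R * (36 * x ^+ 2 - 4) ^+ k * ratr (bernoulli (2 * k)) *
        (balancing_poly R[i] (n - 2 * k)).[x])
  = n%:R * (\sum_(k < n)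
               'C(n - 1, k)%:R * (balancing_poly R[i] (2 * k + 1)).[x]
            - (6 * x) ^+ n / 2 * (balancing_poly R[i] (n - 1)).[x])
  /\
  (6 * x) ^ (n%:Z - 1) *
    (\sum_(k < n./2.+1)
        'C(n, 2 * k)%:R * (4 ^+ k - 1) * (36 * x ^+ 2 - 4) ^+ k *
        ratr (bernoulli (2 * k)) *
        (lucas_balancing_poly R[i] (n - 2 * k)).[x])
  = n%:R * (\sum_(k < n)
               'C(n - 1, k)%:R * (lucas_balancing_poly R[i] (2 * k + 1)).[x]
            - (6 * x) ^+ n / 2 * (lucas_balancing_poly R[i] (n - 1)).[x]).
Proof. exact: balancing_bernoulli_sums. Qed.
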